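(* For every integer $k\geq 6$, any deterministic distributed dynamic data structure for $k$-cycle listing that handles edge insertions and deletions requires $\Omega\left(\frac{\sqrt{n}}{\log n}\right)$ amortized rounds.
   Context: Highly dynamic network model: a synchronous network on a fixed set $V$ of $n$ nodes with unique identifiers starts as the empty graph; at the beginning of round $i$ the graph is $G_i=(V,E_i)$, obtained from the previous graph by an adversary inserting and/or deleting an arbitrary (unbounded) set of edges. At the start of each round every node is notified only of the insertions/deletions of edges incident to it; then each node may send a message of $O(\log n)$ bits to each of its current neighbors. A distributed dynamic data structure consists of a local part $DS_v$ at each node $v$; at the end of every round, $DS_v$ may be queried and must answer immediately, without any further communication, with $\texttt{true}$, $\texttt{false}$ or $\texttt{inconsistent}$. The amortized round complexity is at most $c$ if for every round $i$, the number of rounds up to round $i$ in which at least one node $v$ has $DS_v$ in an inconsistent state, divided by the total number of topology changes that occurred up to round $i$, is at most $c$. $k$-cycle listing: in round $i$, $DS_v$ at each node $v$ responds to queries of the form $H=\{v,u_1,\ldots,u_{k-1}\}$ (a cyclically ordered set of $k$ nodes containing $v$) with $\texttt{true}$, $\texttt{false}$ or $\texttt{inconsistent}$, such that if all nodes of $H$ are queried with $H$, then either at least one node responds $\texttt{inconsistent}$, or at least one node responds $\texttt{true}$ if and only if $H$ is a $k$-cycle in $G_{i-1}$. *)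

(* Defs.v *)
From mathcomp Require Import all_boot.
From Stdlib Require Import Reals.
Set Implicit Arguments.
Unset Strict Implicit.
Unset Printing Implicit Defensive.

Inductive answer := ATrue | AFalse | AInconsistent.
Definition is_true_ans (a : answer) : bool := if a is ATrue then true else false.
Definition is_incons (a : answer) : bool := if a is AInconsistent then true else false.

(** A (simple, undirected) dynamic graph on the node set 'I_n:
    G i is the graph at the beginning of round i (G 0 is the empty graph). *)
Definition dyn_graph (n : nat) := nat -> rel 'I_n.

Definition valid_dyn_graph n (G : dyn_graph n) : Prop :=
  (forall u v, G 0 u v = false) /\
  (forall i u v, G i u v = G i v u) /\
  (forall i v, G i v v = false).

Definition changes n (G : dyn_graph n) (i : nat) : nat :=
  #|[set p : 'I_n * 'I_n | (p.1 < p.2) && (G i p.1 p.2 != G i.-1 p.1 p.2)]|.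

(** A deterministic distributed dynamic data structure on n nodes.
    Each node has a local state (of arbitrary type); per round it is
    - notified of the inserted / deleted edges incident to it
      (as the sets of other endpoints),
    - sends a message (a bit string) to each current neighbour,
    - updates its state from the messages received from its neighbours.
    At the end of each round its local part answers queries without
    communication, as a function of its local state. *)
Record DDS (n : nat) := {
  St : Type;
  init : 'I_n -> St;
  notify : 'I_n -> St -> {set 'I_n} -> {set 'I_n} -> St;
  send : 'I_n -> St -> 'I_n -> seq bool;
  receive : 'I_n -> St -> ('I_n -> option (seq bool)) -> St;
  query : 'I_n -> St -> seq 'I_n -> answer
}.
Arguments St {n} d.
Arguments init {n} d _.
Arguments notify {n} d _ _ _ _.
Arguments send {n} d _ _ _.
Arguments receive {n} d _ _ _.
Arguments query {n} d _ _ _.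

Definition bandwidth n (A : DDS n) (B : nat) : Prop :=
  forall v s u, size (send A v s u) <= B.

Fixpoint state n (A : DDS n) (G : dyn_graph n) (i : nat) : 'I_n -> St A :=
  match i with
  | 0 => init A
  | j.+1 => fun v =>
      let s1 := fun w => notify A w (state A G j w)
                           [set u | G j.+1 w u && ~~ G j w u]
                           [set u | G j w u && ~~ G j.+1 w u] in
      receive A v (s1 v)
        (fun u => if G j.+1 u v then Some (send A u (s1 u) v) else None)
  end.

Definition ans n (A : DDS n) (G : dyn_graph n) (i : nat) (v : 'I_n)
  (H : seq 'I_n) : answer := query A v (state A G i v) H.

Definition is_kcycle n (k : nat) (g : rel 'I_n) (H : seq 'I_n) : bool :=
  (size H == k) && uniq H && cycle g H.

Definition lists_kcycles n (k : nat) (A : DDS n) : Prop :=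
  forall G : dyn_graph n, valid_dyn_graph G ->
  forall i : nat, 0 < i ->
  forall H : k.-tuple 'I_n, uniq H ->
    (exists2 v, v \in H & is_incons (ans A G i v H)) \/
    ((exists2 v, v \in H & is_true_ans (ans A G i v H)) <->
      is_kcycle k (G i.-1) H).

(** Round i has some node whose local data structure is in an inconsistent
    state, i.e. answers inconsistent to some (valid) query. *)
Definition bad_round n (k : nat) (A : DDS n) (G : dyn_graph n) (i : nat) : bool :=
  [exists v : 'I_n, [exists H : k.-tuple 'I_n,
     (v \in H) && uniq H && is_incons (ans A G i v H)]].

(** Amortized round complexity at most c:
    for every round i, #(inconsistent rounds among 1..i) <= c * #(changes in 1..i)
    (the multiplicative form of the ratio condition). *)
Definition amortized_le n (k : nat) (A : DDS n) (c : R) : Prop :=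
  forall G : dyn_graph n, valid_dyn_graph G ->
  forall i : nat,
    Rle (INR (\sum_(1 <= j < i.+1) (bad_round k A G j : nat)))
        (Rmult c (INR (\sum_(1 <= j < i.+1) changes G j))).

(* Main.v *)
(* Take s ~ sqrt n left and s right components, each holding a secret subset of
   an s-element set that is known only inside the component, and link every
   left-right pair (a, b) by two edges for L ~ s / log n rounds, one pair after
   the other.  A pair of elements of the two secrets closes a k-cycle through
   the two links, so in a consistent round of the phase of (a, b) one of the
   two components can read off the other's secret from its own answers.  If at
   least half of the phases had a consistent round, some component would learn
   s/4 secrets, i.e. s^2/4 bits, while it receives only O(s L log n) bits:
   counting codes (own secret, received messages, learning times, unlearnt
   secrets) shows that this fails for some choice of secrets.  For that choice
   Omega(s^2 L) rounds are inconsistent, with only O(n + s^2) = O(s^2) topology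
   changes. *)
Require Import Defs.
From mathcomp Require Import all_boot zify.
From Stdlib Require Import Reals Lra FunctionalExtensionality.

Set Implicit Arguments.
Unset Strict Implicit.
Unset Printing Implicit Defensive.

(** * Numbering of finite types and finite codes for messages *)

(** Partial inverse of [enum_rank] on all naturals. It reads node numbers as sites and phase numbers
    as pairs; [None] stands for isolated nodes and for phases after the last pair. *)
Definition unrank (T : finType) (m : nat) : option T := omap (@enum_val T T) (insub m).

Lemma unrankK (T : finType) (x : T) : unrank T (enum_rank x) = Some x.
Proof. by rewrite /unrank valK /= enum_rankK. Qed.

Lemma unrank_Some (T : finType) m (x : T) :
  unrank T m = Some x -> m = enum_rank x.
Proof.
rewrite /unrank; case: insubP => //= i _ <- [<-].
by rewrite enum_valK.
Qed.

(** [None] marks the positions past the end, so strings of length at most [B] embed in a type with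
    3^B elements and transcripts can be counted. *)
Definition encode_bits (B : nat) (w : seq bool) : {ffun 'I_B -> option bool} :=
  [ffun i : 'I_B => onth w i].

Lemma encode_bits_inj (B : nat) (w w' : seq bool) :
  size w <= B -> size w' <= B -> encode_bits B w = encode_bits B w' -> w = w'.
Proof.
move=> wB w'B /ffunP eqw; apply: eq_from_onth => i.
case: (ltnP i B) => [iB|Bi]; first by have := eqw (Ordinal iB); rewrite !ffunE.
by rewrite !onth_default //; apply: leq_trans Bi.
Qed.

(** * The dynamic graph and its topology changes *)

Section Gadget.

Variables (n d s L : nat).

(* There are [s] left ([false]) and [s] right ([true]) components.  Inside a
   component, a node X is joined through those [p : 'I_s] that belong to its
   input set to the first node of a path Y^0, .., Y^d.  While the pair (a, b) is
   linked, X_a is joined to X_b, and Y_a^d to Y_b^0. *)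
Definition component : finType := (bool * 'I_s)%type.
Definition role : finType := option ('I_d.+1 + 'I_s)%type.
Definition site : finType := (component * role)%type.

Definition rX : role := None.
Definition rY (i : 'I_d.+1) : role := Some (inl i).
Definition rP (p : 'I_s) : role := Some (inr p).

Definition inputs : finType := {ffun component -> {set 'I_s}}.

Definition port (side slot : bool) : role :=
  if slot then rX else rY (if side then ord0 else ord_max).

(** Each edge appears in one orientation only; [gadget] symmetrizes. *)
Definition intra (S : inputs) (l l' : site) : bool :=
  (l.1 == l'.1) &&
  match l.2, l'.2 with
  | None, Some (inr p) => p \in S l.1
  | Some (inl i), Some (inr p) => (i == ord0) && (p \in S l.1)
  | Some (inl i), Some (inl j) => (j : nat) == i.+1
  | _, _ => false
  end.

Definition cross (ab : 'I_s * 'I_s) (l l' : site) : bool :=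
  [exists slot, (l == ((false, ab.1), port false slot)) &&
                (l' == ((true, ab.2), port true slot))].

Definition site_edge (S : inputs) (j : nat) (l l' : site) : bool :=
  if j is i.+1 then
    intra S l l' ||
    (if unrank ('I_s * 'I_s)%type (i %/ L) is Some ab then cross ab l l'
     else false)
  else false.

(* The pairs take turns, each staying linked for [L] consecutive rounds; the
   nodes of ['I_n] that carry no site stay isolated. *)
Definition gadget (S : inputs) : dyn_graph n := fun j u v =>
  match unrank site u, unrank site v with
  | Some l, Some l' => site_edge S j l l' || site_edge S j l' l
  | _, _ => false
  end.

Lemma crossP ab l l' :
  reflect (exists slot, l = ((false, ab.1), port false slot) /\
                        l' = ((true, ab.2), port true slot)) (cross ab l l').
Proof.
apply: (iffP existsP) => [[t /andP[/eqP-> /eqP->]]|[t [-> ->]]]; exists t => //.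
by rewrite !eqxx.
Qed.

Lemma site_edge_irrefl S j l : site_edge S j l l = false.
Proof.
case: j => //= j; rewrite /intra eqxx /=.
have -> : (if unrank ('I_s * 'I_s)%type (j %/ L) is Some ab then cross ab l l
     else false) = false.
  by case: unrank => // ab; apply/crossP => -[t [->]].
case: l.2 => // -[i|//]; rewrite orbF; lia.
Qed.

Lemma gadget_valid S : valid_dyn_graph (gadget S).
Proof.
split; [|split] => [u v|j u v|j v]; rewrite /gadget.
- by case: (unrank site u) => [l|]; case: (unrank site v) => [l'|].
- by case: (unrank site u) => [l|]; case: (unrank site v) => [l'|] //; rewrite orbC.
- by case: unrank => // l; rewrite site_edge_irrefl.
Qed.

Lemma card_component : #|component| = 2 * s.
Proof. by rewrite card_prod card_bool card_ord. Qed.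

Lemma card_site : #|site| = 2 * s * (s + d.+2).
Proof. by rewrite !card_prod card_bool card_option card_sum !card_ord; lia. Qed.

(** A changed node pair carries a changed site pair in one of the two orientations, and [unrank] is
    injective where defined, so each orientation contributes at most [#|D|]. *)
Lemma changes_le_site_edge S j :
  changes (gadget S) j <=
  2 * #|[set x : site * site | site_edge S j x.1 x.2 != site_edge S j.-1 x.1 x.2]|.
Proof.
set D := finset _.
pose f (p : 'I_n * 'I_n) := (unrank site p.1, unrank site p.2).
have finj : injective (fun p : site * site => (Some p.1, Some p.2)).
  by move=> [? ?] [? ?] [-> ->].
have unrank_inj (u u' : 'I_n) (l : site) :
    unrank site u = Some l -> unrank site u' = Some l -> u = u'.
  by move=> /unrank_Some e /unrank_Some e'; apply: val_inj; rewrite /= e e'.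
pose D1 := [set p | [exists x in D, f p == (Some x.1, Some x.2)]].
pose D2 := [set p | [exists x in D, f p == (Some x.2, Some x.1)]].
have card1 : #|D1| <= #|D|.
  rewrite -(card_imset (mem D) finj).
  have: {in D1 &, injective f}.
    move=> [u v] [u' v']; rewrite !inE => /existsP[x /andP[_ /eqP e]].
    move=> /existsP[x' /andP[_ /eqP e']] ee; move: e e'; rewrite -ee => e e'.
    move: (e); rewrite {}e' => -[e1 e2]; move: ee e; rewrite /f /= => -[a b] [c h].
    by rewrite (unrank_inj _ _ _ c (etrans (esym a) c)) (unrank_inj _ _ _ h (etrans (esym b) h)).
  move/card_in_imset <-; apply: subset_leq_card; apply/subsetP => _ /imsetP[p pD ->].
  move: pD; rewrite inE => /existsP[x /andP[xD /eqP->]]; exact: imset_f.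
have card2 : #|D2| <= #|D|.
  apply: leq_trans card1.
  have swap_inj : injective (fun p : 'I_n * 'I_n => (p.2, p.1)).
    by move=> [? ?] [? ?] [-> ->].
  rewrite -(card_imset (mem D2) swap_inj).
  apply: subset_leq_card; apply/subsetP => _ /imsetP[[u v] uvD ->].
  move: uvD; rewrite !inE /f /= => /existsP[x /andP[xD /eqP[-> ->]]].
  by apply/existsP; exists x; rewrite xD eqxx.
rewrite mul2n -addnn; apply: leq_trans (leq_add card1 card2).
apply: leq_trans (leq_card_setU D1 D2).
apply: subset_leq_card; apply/subsetP => -[u v]; rewrite !inE /= => /andP[_].
rewrite /gadget.
case eu: (unrank site u) => [l|]; case ev: (unrank site v) => [l'|] // neq.
have [D'|nD] := boolP ((l, l') \in D).
  by apply/orP; left; apply/existsP; exists (l, l'); rewrite D' /f /= eu ev eqxx.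
apply/orP; right; apply/existsP; exists (l', l); rewrite /f /= eu ev eqxx andbT.
rewrite inE /=; move: nD neq; rewrite inE negbK /= => /eqP->.
by case: site_edge => //; case: site_edge; case: site_edge.
Qed.

(** Charge each edge to its second endpoint: a P-node is entered only from X or Y^0, and Y^j only
    from Y^(j-1), so a flag for X determines the first endpoint. *)
Lemma card_intra S : #|[set x : site * site | intra S x.1 x.2]| <= 2 * #|site|.
Proof.
pose g (y : site * bool) : site * site :=
  let: (c, r) := y.1 in
  ((c, if y.2 then rX else
       if r is Some (inl j) then rY (inord j.-1) else rY ord0), y.1).
rewrite mulnC -[2]card_bool -card_prod -cardsT.
apply: leq_trans (leq_imset_card g _); apply: subset_leq_card; apply/subsetP.
move=> [[c r] [c' r']]; rewrite inE /intra /= => /andP[/eqP <-] rr'.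
apply/imsetP; exists ((c, r'), r == rX); first by rewrite inE.
rewrite /g /=.
move: r r' rr' => [[i|p]|] [[j|q]|] //=.
  by move/eqP => e; rewrite e /= inord_val.
by case/andP => /eqP ->.
Qed.

Lemma card_cross ab : #|[set x : site * site | cross ab x.1 x.2]| <= 2.
Proof.
rewrite -card_bool -cardsT.
pose g t : site * site := (((false, ab.1), port false t), ((true, ab.2), port true t)).
apply: leq_trans (leq_imset_card g _); apply: subset_leq_card; apply/subsetP.
move=> [l l']; rewrite inE => /crossP[t /= [-> ->]].
by apply/imsetP; exists t.
Qed.

Definition cross_at (m : nat) : {set site * site} :=
  [set x | if unrank ('I_s * 'I_s)%type m is Some ab then cross ab x.1 x.2
           else false].

Lemma card_cross_at m : #|cross_at m| <= 2.
Proof.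
rewrite /cross_at; case: unrank => [ab|]; first exact: card_cross.
by rewrite (_ : finset _ = set0) ?cards0 //; apply/setP => x; rewrite !inE.
Qed.

Lemma changes_first S : changes (gadget S) 1 <= 4 * #|site| + 4.
Proof.
apply: leq_trans (changes_le_site_edge S 1) _.
rewrite -[4]/(2 * 2) -mulnA -mulnDr leq_pmul2l //.
apply: leq_trans (leq_add (card_intra S) (card_cross_at (0 %/ L))).
apply: leq_trans (leq_card_setU _ _); apply: subset_leq_card; apply/subsetP.
by move=> x; rewrite !inE /=; case: (_ || _).
Qed.

Lemma changes_next S j : changes (gadget S) j.+2 <= 8.
Proof.
apply: leq_trans (changes_le_site_edge S _) _.
rewrite -[8]/(2 * (2 + 2)) leq_pmul2l //.
apply: leq_trans (leq_add (card_cross_at (j %/ L)) (card_cross_at (j.+1 %/ L))).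
apply: leq_trans (leq_card_setU _ _); apply: subset_leq_card; apply/subsetP.
move=> x; rewrite !inE /=; case: intra => //=.
by do 2 case: (if _ is Some _ then _ else _).
Qed.

Lemma changes_same_phase S j :
  j %/ L = j.+1 %/ L -> changes (gadget S) j.+2 = 0.
Proof.
move=> e; apply/eqP; rewrite -leqn0; apply: leq_trans (changes_le_site_edge S _) _.
rewrite leqn0 muln_eq0 /= cards_eq0; apply/eqP/setP => x.
by rewrite !inE /= e eqxx.
Qed.

(** Round 1 builds the components; afterwards only the first round of a phase changes anything,
    removing at most two links and adding at most two. *)
Lemma sum_changes S m : 0 < L -> 0 < m ->
  \sum_(1 <= j < (m * L).+1) changes (gadget S) j <= 4 * #|site| + 8 * m.
Proof.
move=> L_gt0; rewrite big_add1 -pred_Sn.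
elim: m => // -[_ _|m IH _].
  rewrite mul1n big_ltn // big_nat big1 => [|[//|j] /andP[_ jL]].
    by have := changes_first S; lia.
  by apply: changes_same_phase; rewrite !divn_small // ltnW.
rewrite (big_cat_nat (n := m.+1 * L)) //; last by rewrite leq_mul2r leqnSn orbT.
have -> : 8 * m.+2 = 8 * m.+1 + 8 by lia.
rewrite addnA; apply: leq_add; first exact: IH.
rewrite big_ltn; last by rewrite mulSnr; lia.
rewrite big_nat big1 ?addn0 => [|[|j] /andP[h1 h2]]; last 2 first.
- by lia.
- apply: changes_same_phase.
  have -> : j = m.+1 * L + (j - m.+1 * L) by lia.
  by rewrite -addnS !divnMDl // !divn_small //; lia.
have := changes_next S (m.+1 * L).-1.
by rewrite prednK ?muln_gt0 /= ?addn0.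
Qed.

End Gadget.

(** * Simulation of a component, witness cycles and decoding *)

Section Protocol.

Variables (n d s L B : nat) (A : DDS n).
Hypothesis site_le_n : #|site d s| <= n.
Hypothesis A_bandwidth : bandwidth A B.
Hypothesis A_lists : lists_kcycles (6 + d) A.

Notation site := (site d s).
Notation inputs := (inputs s).
Notation component := (component s).
Notation graph S := (@gadget n d s L S).

Definition emb (l : site) : 'I_n := widen_ord site_le_n (enum_rank l).

Lemma embK l : unrank site (emb l) = Some l.
Proof. exact: unrankK. Qed.

Lemma emb_inj : injective emb.
Proof. by move=> l l' e; apply: Some_inj; rewrite -!embK e. Qed.

Lemma unrank_emb (v : 'I_n) l : unrank site v = Some l -> v = emb l.
Proof. by move/unrank_Some => e; apply: val_inj. Qed.

Definition in_component (c : component) (v : 'I_n) : bool :=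
  if unrank site v is Some l then l.1 == c else false.

Definition pair_of (c : component) (j : 'I_s) : 'I_s * 'I_s :=
  if c.1 then (j, c.2) else (c.2, j).

Definition partner (c : component) (j : 'I_s) : component := (~~ c.1, j).

Definition slice (ab : 'I_s * 'I_s) (r : nat) : nat := enum_rank ab * L + r.

(** The intermediate state from which [u] computes its messages of round [j.+1]. *)
Definition noted (S : inputs) j u : St A :=
  notify A u (state A (graph S) j u)
    [set w | graph S j.+1 u w && ~~ graph S j u w]
    [set w | graph S j u w && ~~ graph S j.+1 u w].

(* Everything [c] ever receives from other components; the two links carry the
   slots [true] (X to X) and [false] (Y to Y). *)
Definition transcript (S : inputs) (c : component) :
    {ffun 'I_s * 'I_L * bool -> {ffun 'I_B -> option bool}} :=
  [ffun x : 'I_s * 'I_L * bool => let u := emb (partner c x.1.1, port d s (~~ c.1) x.2) in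
     encode_bits B (send A u (noted S (slice (pair_of c x.1.1) x.1.2) u)
                           (emb (c, port d s c.1 x.2)))].

(** Inner edges stay within one component, and the schedule of the links does not depend on the
    inputs. *)
Lemma gadget_local (S S' : inputs) c j u v :
  S c = S' c -> in_component c v -> graph S j v u = graph S' j v u.
Proof.
rewrite /in_component /gadget => eqS.
case: (unrank site v) => // l /eqP lc; case: (unrank site u) => // l'.
case: j => //= j; suff [-> ->] : intra S l l' = intra S' l l' /\
                                 intra S l' l = intra S' l' l by [].
rewrite /intra lc eqS; split=> //.
by have [->|] := eqVneq l'.1 c; rewrite ?eqS.
Qed.

Lemma gadget_sym (S : inputs) j u v : graph S j u v = graph S j v u.
Proof. by have [_ [-> _]] := gadget_valid n d L S. Qed.

Lemma gadget_crossing (S : inputs) j c u v :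
  graph S j.+1 u v -> in_component c v -> ~~ in_component c u ->
  exists i slot, [/\ unrank ('I_s * 'I_s)%type (j %/ L) = Some (pair_of c i),
    u = emb (partner c i, port d s (~~ c.1) slot) &
    v = emb (c, port d s c.1 slot)].
Proof.
rewrite /in_component /gadget.
case eu: (unrank site u) => [l|//]; case ev: (unrank site v) => [l'|//] /=.
move=> adj /eqP l'c lc; rewrite (unrank_emb eu) (unrank_emb ev).
have : if unrank ('I_s * 'I_s)%type (j %/ L) is Some ab
       then cross ab l l' || cross ab l' l else false.
  move: adj; rewrite /intra l'c [c == _]eq_sym (negPf lc) /=.
  by case: unrank.
case: unrank => // -[a b] /orP[] /crossP[slot /= [el el']];
  exists (if c.1 then a else b); exists slot; move: l'c; rewrite el el' /= => <-;
  by split.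
Qed.

(** Induction on rounds: notifications depend on the component's own input, messages from inside are
    equal by induction, and messages from outside cross a link, so the transcript records them; the
    bandwidth bound makes the record lossless. *)
Lemma state_local (S S' : inputs) c : 0 < L ->
  S c = S' c -> transcript S c = transcript S' c ->
  forall j v, in_component c v -> state A (graph S) j v = state A (graph S') j v.
Proof.
move=> L_gt0 eqS /ffunP eqT; elim=> // j IH v vc.
have eq_noted u : in_component c u -> noted S j u = noted S' j u.
  move=> uc; rewrite /noted IH //; congr notify; apply/setP => w;
  by rewrite !inE !(gadget_local _ _ eqS).
have -> T : state A (graph T) j.+1 v = receive A v (noted T j v)
    (fun u => if graph T j.+1 u v then Some (send A u (noted T j u) v) else None).
  by [].
rewrite eq_noted //; congr receive; apply: functional_extensionality => u.
rewrite [graph S _ _ _]gadget_sym [graph S' _ _ _]gadget_sym.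
rewrite (gadget_local _ _ eqS) //.
case adj: (graph S' _ _ _) => //; congr Some.
have [uc|uc] := boolP (in_component c u); first by rewrite eq_noted.
rewrite gadget_sym in adj.
have [i [slot [ph eu ev]]] := gadget_crossing adj vc uc.
have jE : j = slice (pair_of c i) (j %% L).
  by rewrite /slice -(unrank_Some ph) -divn_eq.
have rL : j %% L < L by rewrite ltn_mod.
have := eqT ((i, Ordinal rL), slot); rewrite !ffunE /= -jE -eu -ev.
by apply: encode_bits_inj; apply: A_bandwidth.
Qed.

(* For [ab = (a, b)]: the closed walk X_a, p, Y_a^0, .., Y_a^d, Y_b^0, q, X_b. *)
Definition witness_sites (ab : 'I_s * 'I_s) (p q : 'I_s) : seq site :=
  [:: ((false, ab.1), rX d s), ((false, ab.1), rP d p) &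
    [seq ((false, ab.1), rY s (inord i)) | i <- iota 0 d.+1] ++
    [:: ((true, ab.2), rY s ord0); ((true, ab.2), rP d q);
        ((true, ab.2), rX d s)]].

Definition witness ab p q : seq 'I_n := map emb (witness_sites ab p q).

Lemma size_witness ab p q : size (witness ab p q) == 6 + d.
Proof. by rewrite /= size_map size_cat size_map size_iota /= addnC. Qed.

Lemma uniq_witness ab p q : uniq (witness ab p q).
Proof.
rewrite map_inj_uniq; last exact: emb_inj.
have : uniq [seq ((false, ab.1), rY s (inord i : 'I_d.+1)) | i <- iota 0 d.+1].
  rewrite map_inj_in_uniq ?iota_uniq // => i j; rewrite !mem_iota.
  by move=> /andP[_ ltid] /andP[_ ltjd] [/(congr1 val)] /=; rewrite !inordK.
have chainE (l : site) :
    l \in [seq ((false, ab.1), rY s (inord i : 'I_d.+1)) | i <- iota 0 d.+1] ->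
    exists i, l = ((false, ab.1), rY s i).
  by case/mapP => i _ ->; exists (inord i).
rewrite /witness_sites; move: {chainE}(map _ _) (chainE) => ch chainE ch_uniq.
have ch0 l : (forall i, l <> ((false, ab.1), rY s i)) -> (l \in ch) = false.
  by move=> ne; apply/negP => /chainE[i /ne].
rewrite /= !inE !mem_cat cat_uniq ch_uniq /= !ch0 // !inE.
by rewrite !xpair_eqE /= !andbF. 
Qed.

Lemma gadget_emb (S : inputs) j l l' :
  graph S j (emb l) (emb l') = site_edge L S j l l' || site_edge L S j l' l.
Proof. by rewrite /gadget !embK. Qed.

Lemma gadget_spoke (S : inputs) j c p slot :
  graph S j.+1 (emb (c, if slot then rX d s else rY s ord0)) (emb (c, rP d p)) =
  (p \in S c).
Proof.
rewrite gadget_emb /= [intra S (c, rP d p) _]/intra /= andbF orFb.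
have noP ab l l' : l.2 = rP d p \/ l'.2 = rP d p -> cross ab l l' = false.
  by move=> h; apply/crossP => -[t [el el']]; move: h; rewrite el el'; case: t {el el'} => -[].
set x := (if unrank _ _ is Some _ then _ else _).
set y := (if unrank _ _ is Some _ then _ else _).
have -> : x = false by rewrite /x; case: unrank => // ab; apply: noP; right.
have -> : y = false by rewrite /y; case: unrank => // ab; apply: noP; left.
by rewrite !orbF /intra eqxx; case: slot @x @y.
Qed.

Lemma gadget_chain (S : inputs) j c i : i < d ->
  graph S j.+1 (emb (c, rY s (inord i))) (emb (c, rY s (inord i.+1))).
Proof.
move=> lt_id; rewrite gadget_emb /= /intra eqxx /= !inordK ?eqxx //; lia.
Qed.

Lemma gadget_cross (S : inputs) ab r slot : r < L ->
  graph S (slice ab r).+1 (emb ((false, ab.1), port d s false slot))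
                           (emb ((true, ab.2), port d s true slot)).
Proof.
move=> rL; rewrite gadget_emb /=; apply/orP; left.
have -> : slice ab r %/ L = enum_rank ab.
  by rewrite /slice divnMDl ?divn_small ?addn0 //; lia.
rewrite unrankK.
by apply/crossP; exists slot.
Qed.

(** During the phase of [ab] both links and the Y-path are present, so only the two edges at p and
    the two at q are in question, and these are exactly the membership tests. *)
Lemma witness_cycle (S : inputs) ab p q r : r < L ->
  is_kcycle (6 + d) (graph S (slice ab r).+1) (witness ab p q) =
  (p \in S (false, ab.1)) && (q \in S (true, ab.2)).
Proof.
move=> rL; rewrite /is_kcycle size_witness uniq_witness.
have := gadget_chain S (slice ab r) (false, ab.1).
have := gadget_cross S ab false rL; have := gadget_cross S ab true rL.
have := gadget_spoke S (slice ab r).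
set g := graph S _ => spoke crossX crossY chain.
have gsym u v : g u v = g v u by apply: gadget_sym.
have ord0E : inord 0 = ord0 :> 'I_d.+1 by apply: val_inj; rewrite /= inordK.
rewrite /witness /witness_sites [iota 0 d.+1]/= /= map_cat rcons_cat cat_path /=.
rewrite ord0E (spoke (false, ab.1) p true) [g (emb (_, rP d p)) _]gsym.
rewrite (spoke (false, ab.1) p false) (spoke (true, ab.2) q false).
rewrite [g (emb (_, rP d q)) _]gsym (spoke (true, ab.2) q true).
rewrite [g (emb (_, rX d s)) _]gsym crossX.
(* Tracking the endpoint as well allows the link at Y^d to be attached. *)
have chain_path m i : i + m <= d ->
  path g (emb ((false, ab.1), rY s (inord i)))
    [seq emb x | x <- [seq ((false, ab.1), rY s (inord i)) | i <- iota i.+1 m]]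
  && (last (emb ((false, ab.1), rY s (inord i)))
    [seq emb x | x <- [seq ((false, ab.1), rY s (inord i)) | i <- iota i.+1 m]]
    == emb ((false, ab.1), rY s (inord (i + m)))).
  elim: m i => [|m IH] i le_imd /=; first by rewrite addn0 eqxx.
  rewrite chain ?addnS; last by lia.
  by rewrite -addSn; apply: IH; lia.
have /andP[] := chain_path d 0 (leqnn d); rewrite ord0E add0n => -> /eqP ->.
have -> : inord d = ord_max :> 'I_d.+1 by apply: val_inj; rewrite /= inordK.
by rewrite crossY /= andbT andbb; case: (p \in _).
Qed.

(* The queries put to component [c] while it is linked to [partner c j]:
   [p] is a node of [c], and [q] a node of the partner. *)
Definition query_of (c : component) (j p q : 'I_s) : seq 'I_n :=
  if c.1 then witness (pair_of c j) q p else witness (pair_of c j) p q.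

Definition decode (S : inputs) (c : component) (j : 'I_s) (r : nat) : {set 'I_s} :=
  [set q | [exists p, has (fun v => in_component c v &&
     is_true_ans (ans A (graph S) (slice (pair_of c j) r).+1 v (query_of c j p q)))
     (query_of c j p q)]].

Lemma decode_local (S S' : inputs) c j r : 0 < L ->
  S c = S' c -> transcript S c = transcript S' c ->
  decode S c j r = decode S' c j r.
Proof.
move=> L_gt0 eqS eqT; apply/setP => q; rewrite !inE.
apply: eq_existsb => p; apply: eq_has => v.
by case vc: in_component => //=; rewrite /ans (state_local L_gt0 eqS eqT).
Qed.

(* Answers [true] are sound, so [decode] only under-approximates the partner's
   input; if both sides missed an element, the cycle through the two missed
   elements would be answered [true] by nobody. *)
Lemma good_round_decodes (S : inputs) ab r : 0 < r < L ->
  ~~ bad_round (6 + d) A (graph S) (slice ab r).+1 ->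
  decode S (false, ab.1) ab.2 r = S (true, ab.2) \/
  decode S (true, ab.2) ab.1 r = S (false, ab.1).
Proof.
(* Answers of a round concern the graph of the preceding round, so a positive offset is what
   guarantees that this graph already contains the links of [ab]. *)
case: r => // r /andP[_ rL] good.
have pairL : pair_of (false, ab.1) ab.2 = ab by case: ab {good}.
have pairR : pair_of (true, ab.2) ab.1 = ab by case: ab {good pairL}.
have queryL p q : query_of (false, ab.1) ab.2 p q = witness ab p q.
  by rewrite /query_of pairL.
have queryR p q : query_of (true, ab.2) ab.1 q p = witness ab p q.
  by rewrite /query_of pairR.
have answers p q : (exists2 v, v \in witness ab p q &
      is_true_ans (ans A (graph S) (slice ab r.+1).+1 v (witness ab p q))) <->
    (p \in S (false, ab.1)) && (q \in S (true, ab.2)).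
  pose H := Tuple (size_witness ab p q).
  have [[v vH inc]|] := A_lists (gadget_valid n d L S) (isT : 0 < (slice ab r.+1).+1)
      (uniq_witness ab p q : uniq H).
    case/negP: good; apply/existsP; exists v; apply/existsP; exists H.
    by rewrite vH inc (uniq_witness ab p q).
  by rewrite /= {2}/slice addnS witness_cycle // ltnW.
have subR : decode S (false, ab.1) ab.2 r.+1 \subset S (true, ab.2).
  apply/subsetP => q; rewrite inE pairL => /existsP[p].
  rewrite queryL => /hasP[v vH /andP[_ tr]].
  by have /answers/andP[] : exists2 v, v \in witness ab p q &
      is_true_ans (ans A (graph S) (slice ab r.+1).+1 v (witness ab p q)) by exists v.
have subL : decode S (true, ab.2) ab.1 r.+1 \subset S (false, ab.1).
  apply/subsetP => p; rewrite inE pairR => /existsP[q].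
  rewrite queryR => /hasP[v vH /andP[_ tr]].
  by have /answers/andP[] : exists2 v, v \in witness ab p q &
      is_true_ans (ans A (graph S) (slice ab r.+1).+1 v (witness ab p q)) by exists v.
have [/eqP|neR] := boolP (decode S (false, ab.1) ab.2 r.+1 == S (true, ab.2)).
  by left.
have [/eqP|neL] := boolP (decode S (true, ab.2) ab.1 r.+1 == S (false, ab.1)).
  by right.
have /subsetPn[q qS qD] : ~~ (S (true, ab.2) \subset decode S (false, ab.1) ab.2 r.+1).
  by apply: contra neR => sub; rewrite eqEsubset subR.
have /subsetPn[p pS pD] : ~~ (S (false, ab.1) \subset decode S (true, ab.2) ab.1 r.+1).
  by apply: contra neL => sub; rewrite eqEsubset subL.
have [v vH tr] : exists2 v, v \in witness ab p q &
      is_true_ans (ans A (graph S) (slice ab r.+1).+1 v (witness ab p q)).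
  by apply/answers; rewrite pS.
(* The node answering [true] lies on the cycle, hence in one of the two components, which therefore
   decodes the element it was supposed to miss. *)
have /orP[vc|vc] : in_component (false, ab.1) v || in_component (true, ab.2) v.
- move: vH; rewrite /witness => /mapP[l lH ->]; rewrite /in_component embK.
  move: lH; rewrite in_cons in_cons mem_cat => /or3P[/eqP->|/eqP->|/orP[/mapP[i _ ->]|]];
    rewrite ?eqxx //.
  by rewrite !inE => /or3P[] /eqP->; rewrite eqxx orbT.
- case/negP: qD; rewrite inE; apply/existsP; exists p; apply/hasP.
  by exists v; rewrite queryL ?pairL ?vc.
- case/negP: pD; rewrite inE; apply/existsP; exists q; apply/hasP.
  by exists v; rewrite queryR ?pairR ?vc.
Qed.


(** * The coding argument and the count of inconsistent rounds *)

(** [decode] may be incomplete at some offsets, so the code must say at which offset to read the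
    partner's input. *)
Definition learn_time (S : inputs) (c : component) : {ffun 'I_s -> option 'I_L} :=
  [ffun j => [pick r : 'I_L | decode S c j r == S (partner c j)]].

Lemma learn_timeP (S : inputs) c j r :
  learn_time S c j = Some r -> decode S c j r = S (partner c j).
Proof. by rewrite ffunE; case: pickP => // r' /eqP e [<-]. Qed.

(** Erasing to [set0] keeps the type of inputs and turns the saving into a support condition,
    counted by [pffun_on]. *)
Definition residue (S : inputs) (c : component) : inputs :=
  [ffun x : component => if (x.1 == ~~ c.1) && learn_time S c x.2 then set0 else S x].

Lemma residueE S c x : residue S c x =
  if (x.1 == ~~ c.1) && learn_time S c x.2 then set0 else S x.
Proof. by rewrite [LHS]ffunE. Qed.

(* [S c] survives in the residue, so with the transcript it lets one replay the
   execution of [c], whose answers then restore the erased inputs. *)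
Lemma code_inj (S S' : inputs) c : 0 < L ->
  transcript S c = transcript S' c -> learn_time S c = learn_time S' c ->
  residue S c = residue S' c -> S = S'.
Proof.
move=> L_gt0 eqT eqR /ffunP eqX.
have eqS : S c = S' c by have := eqX c; rewrite !residueE; case: (c.1).
apply/ffunP => x; move: {eqX}(eqX x); rewrite !residueE -eqR.
case: ifP => [/andP[/eqP side learnt] _|_ -> //].
have -> : x = partner c x.2 by case: x side {learnt} => ? ? /= ->.
move: learnt; case e: (learn_time S c x.2) => [r|]; last by [].
move=> _.
have e' : learn_time S' c x.2 = Some r by rewrite -eqR.
by rewrite -(learn_timeP e) -(learn_timeP e'); apply: decode_local.
Qed.

(** On a fiber the residue is injective by [code_inj], and each learnt partner removes one set, that
    is a factor 2^s. *)
Lemma card_fiber c tr (T : {ffun 'I_s -> option 'I_L}) : 0 < L ->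
  #|[set S : inputs | (transcript S c == tr) && (learn_time S c == T)]| <=
  expn (expn 2 s) (2 * s - #|[set j | isSome (T j)]|).
Proof.
move=> L_gt0; set F := finset _.
pose erased := [set x : component | (x.1 == ~~ c.1) && T x.2].
have card_erased : #|erased| = #|[set j | isSome (T j)]|.
  have pinj : injective (partner c) by move=> i j [].
  rewrite -(card_imset _ pinj); apply: eq_card => -[b j]; rewrite !inE /=.
  apply/idP/imsetP => [/andP[/eqP -> Tj]|[i Ti [-> ->]]]; last first.
    by rewrite eqxx; rewrite inE in Ti.
  by exists j; rewrite ?inE.
have res_inj : {in F &, injective (fun S => residue S c)}.
  move=> S S'; rewrite !inE => /andP[/eqP e1 /eqP e2] /andP[/eqP e3 /eqP e4].
  exact: code_inj L_gt0 (etrans e1 (esym e3)) (etrans e2 (esym e4)).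
rewrite -(card_in_imset res_inj).
have <- : #|pffun_on (set0 : {set 'I_s}) (mem (~: erased)) predT| =
          expn (expn 2 s) (2 * s - #|[set j | isSome (T j)]|).
  rewrite card_pffun_on -cardsT -powersetT card_powerset cardsT card_ord.
  by congr expn; rewrite -card_erased -(card_component s) -(cardsC erased) addKn.
apply: subset_leq_card; apply/subsetP => _ /imsetP[S SF ->].
apply/pffun_onP; split => //; apply/subsetP => x; rewrite !inE residueE.
by move: SF; rewrite inE => /andP[_ /eqP ->]; case: (_ && _); rewrite ?eqxx.
Qed.

(** Otherwise every input has a component that learns at least [m] partners. The factors count this
    component, its transcript, its learning times and the residue; their product would bound the
    number of all inputs. *)
Lemma exists_hard_input m : 0 < L ->
  2 * s * expn (expn 3 B) (s * L * 2) * expn L.+1 s * expn (expn 2 s) (2 * s - m)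
    < expn (expn 2 s) (2 * s) ->
  exists S, forall c, #|[set j | isSome (learn_time S c j)]| < m.
Proof.
move=> L_gt0 small.
have [/existsP[S /forallP hS]|noS] := boolP [exists S : inputs,
    [forall c, #|[set j | isSome (learn_time S c j)]| < m]]; first by exists S.
have {noS} /fin_all_exists[c hc] (S : inputs) :
    exists c, m <= #|[set j | isSome (learn_time S c j)]|.
  move: noS; rewrite negb_exists => /forallP/(_ S).
  by rewrite negb_forall => /existsP[c]; rewrite -leqNgt; exists c.
suff: #|{: inputs}| <= 2 * s * expn (expn 3 B) (s * L * 2) * expn L.+1 s *
                     expn (expn 2 s) (2 * s - m).
  rewrite card_ffun card_component -cardsT -powersetT card_powerset cardsT card_ord.
  by move/leq_ltn_trans => /(_ _ small); rewrite ltnn.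
pose code S := (c S, transcript S (c S), learn_time S (c S)).
rewrite -sum1_card (partition_big code predT) //=.
have <- : #|{: component * {ffun 'I_s * 'I_L * bool -> {ffun 'I_B -> option bool}} *
         {ffun 'I_s -> option 'I_L}}| =
       2 * s * expn (expn 3 B) (s * L * 2) * expn L.+1 s.
  by rewrite !card_prod !card_ffun !card_prod !card_option !card_bool !card_ord.
rewrite -sum_nat_const; apply: leq_sum => -[[c0 tr] T] _.
rewrite sum1dep_card.
have [mT|Tm] := leqP m #|[set j | isSome (T j)]|.
  apply: leq_trans (leq_trans (card_fiber c0 tr T L_gt0) _).
    apply: subset_leq_card; apply/subsetP => S; rewrite !inE => /eqP[<- <- <-].
    by rewrite !eqxx.
  by apply: leq_pexp2l; rewrite ?expn_gt0 // leq_sub2l.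
rewrite (_ : finset _ = set0) ?cards0 //; apply/setP => S; rewrite !inE.
by apply/negP => /eqP[_ _ eT]; have := hc S; rewrite eT leqNgt Tm.
Qed.

Definition good_phase (S : inputs) (ab : 'I_s * 'I_s) : bool :=
  [exists r : 'I_L, (0 < r) && ~~ bad_round (6 + d) A (graph S) (slice ab r).+1].

(** Each good phase is charged to an endpoint that learns its partner; [pair_of] recovers the phase
    from this component and the partner's index. *)
Lemma card_good_phase (S : inputs) :
  #|[set ab | good_phase S ab]| <= \sum_c #|[set j | isSome (learn_time S c j)]|.
Proof.
pose f (x : component * 'I_s) := pair_of x.1 x.2.
pose K := [set x : component * 'I_s | isSome (learn_time S x.1 x.2)].
have -> : \sum_c #|[set j | isSome (learn_time S c j)]| = #|K|.
  rewrite -sum1_card (eq_bigr (fun c => \sum_(j | learn_time S c j) 1)) => [|c _].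
    by rewrite pair_big_dep; apply: eq_bigl => x; rewrite inE.
  by rewrite sum1dep_card.
apply: leq_trans (leq_imset_card f _); apply: subset_leq_card.
apply/subsetP => -[a b]; rewrite inE => /existsP[r /andP[r_gt0 good]].
have rL : 0 < r < L by rewrite r_gt0 ltn_ord.
have [/= e|/= e] := good_round_decodes rL good.
- apply/imsetP; exists ((false, a), b) => //; rewrite inE ffunE.
  by case: pickP => // /(_ r); rewrite e eqxx.
- apply/imsetP; exists ((true, b), a) => //; rewrite inE ffunE.
  by case: pickP => // /(_ r); rewrite e eqxx.
Qed.

(** A phase that is not good is inconsistent at every positive offset. Offset 0, whose answers
    concern the previous graph, is given up; hence [L.-1]. *)
Lemma sum_bad_round (S : inputs) : 0 < L ->
  L.-1 * #|[set ab | ~~ good_phase S ab]| <=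
  \sum_(1 <= j < (s * s * L).+1) bad_round (6 + d) A (graph S) j.
Proof.
have card_ss : #|{: 'I_s * 'I_s}| = s * s by rewrite card_prod card_ord.
move=> L_gt0; rewrite big_add1 -pred_Sn -card_ss big_nat_mul big_mkord.
rewrite (reindex (@enum_rank _)) /=; last exact/onW_bij/enum_rank_bij.
rewrite mulnC -sum1_card big_distrl /= big_mkcond.
apply: leq_sum => ab _; rewrite inE; case: ifP => // /existsPn bad.
rewrite mul1n mulSnr -{1}[_ * L]add0n big_addn addKn big_ltn //.
apply: leq_trans (leq_addl _ _).
rewrite -subn1 -[L - 1]muln1 -sum_nat_const_nat big_nat [leqRHS]big_nat.
apply: leq_sum => r /andP[r_gt0 rL].
have := bad (Ordinal rL); rewrite r_gt0 /= negbK /slice [_ * L + _]addnC.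
by move->.
Qed.

End Protocol.

(** * Choice of parameters in the counting bound *)

(** With 2s <= 2^s, 3 <= 2^2 and L+1 <= 2^L the first three factors amount to at most s(1 + L(1 +
    4B)) bits, fewer than the s m bits saved. *)
Lemma code_count (s L B m : nat) : 0 < s -> m <= 2 * s ->
  1 + L * (1 + 4 * B) < m ->
  2 * s * expn (expn 3 B) (s * L * 2) * expn L.+1 s * expn (expn 2 s) (2 * s - m)
    < expn (expn 2 s) (2 * s).
Proof.
move=> s_gt0 m_le small.
rewrite -{3}(subnKC m_le) expnD ltn_pmul2r ?expn_gt0 //.
have two_s : 2 * s <= expn 2 s.
  by rewrite -{2}(prednK s_gt0) expnS leq_pmul2l // -(prednK s_gt0) ltn_expl.
have expn_mono a b e : a <= b -> expn a e <= expn b e.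
  by case: e => // e; rewrite leq_exp2r.
have three_B : expn (expn 3 B) (s * L * 2) <= expn 2 (s * (L * 4 * B)).
  have -> : s * (L * 4 * B) = 2 * (B * (s * L * 2)) by lia.
  by rewrite -expnM (expnM 2 2) expn_mono.
have L_s : expn L.+1 s <= expn 2 (s * L).
  by rewrite mulnC expnM expn_mono // ltn_expl.
apply: (@leq_ltn_trans (expn 2 s * expn 2 (s * (L * 4 * B)) * expn 2 (s * L))).
  by rewrite !leq_mul.
rewrite -!expnD -expnM ltn_exp2l //.
by have -> : s + s * (L * 4 * B) + s * L = s * (1 + L * (1 + 4 * B)); [lia|rewrite ltn_pmul2l].
Qed.

Lemma hard_dyn_graph (n d s L B : nat) (A : DDS n) :
  bandwidth A B -> lists_kcycles (6 + d) A -> 0 < L ->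
  2 * s * (s + d.+2) <= n -> 4 * (1 + L * (1 + 4 * B)) < s ->
  exists (G : dyn_graph n) (i : nat), [/\ valid_dyn_graph G,
    L.-1 * (s * s) <= 2 * \sum_(1 <= j < i.+1) bad_round (6 + d) A G j &
    \sum_(1 <= j < i.+1) changes G j <= 4 * n + 8 * (s * s)].
Proof.
rewrite -card_site => bw lists L_gt0 site_n small.
(* With m the ceiling of s/4, each of the 2s components learns at most m - 1 <= s/4 partners, so at
   most half of the s^2 phases are good. *)
have [] := @exists_hard_input n d s L B A site_n bw (s.+3 %/ 4) L_gt0.
  by apply: code_count; lia.
move=> S hard; exists (@gadget n d s L S), (s * s * L).
split; first exact: gadget_valid.
- have := @sum_bad_round n d s L A S L_gt0.
  have := @card_good_phase n d s L A site_n lists S.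
  have : \sum_(c : component s) #|[set j | isSome (learn_time L A site_n S c j)]|
         <= 2 * s * (s.+3 %/ 4).-1.
    rewrite -card_component -sum_nat_const; apply: leq_sum => c _.
    by have := hard c; lia.
  have := cardsC [set ab | good_phase d L A S ab].
  rewrite card_prod !card_ord.
  rewrite (_ : ~: _ = [set ab | ~~ good_phase d L A S ab]); last first.
    by apply/setP => ab; rewrite !inE.
  move: (\sum_(c : _) _) #|_| #|_| (\sum_(_ <= _ < _) _) => X Z Y W YZ hX YX hW.
  have h1 : 2 * Y <= s * s.
    have : s * (4 * (s.+3 %/ 4).-1) <= s * s by rewrite leq_pmul2l; lia.
    by lia.
  have h2 : s * s <= 2 * Z by lia.
  have : L.-1 * (s * s) <= L.-1 * (2 * Z) by rewrite leq_mul2l h2 orbT.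
  by lia.
- have ss_gt0 : 0 < s * s by rewrite muln_gt0; lia.
  apply: leq_trans (@sum_changes n d s L S (s * s) L_gt0 ss_gt0) _.
  by rewrite leq_add2r leq_pmul2l.
Qed.

(** * Passage to real numbers and asymptotics *)

Lemma INR_expn2 m : INR (expn 2 m) = (2 ^ m)%R.
Proof.
elim: m => [|m IH] //; rewrite expnS /=.
by rewrite -multE mult_INR IH.
Qed.

Lemma INR_leq m n : m <= n -> (INR m <= INR n)%R.
Proof. by move/leP; apply: le_INR. Qed.

Lemma INR_muln m n : INR (m * n) = (INR m * INR n)%R.
Proof. by rewrite -multE mult_INR. Qed.

Lemma one_le_ln n : 3 <= n -> (1 <= ln (INR n))%R.
Proof.
move/INR_leq => /= n3; have e3 := exp_le_3.
rewrite -(ln_exp 1).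
have [h|->] : (exp 1 < INR n \/ exp 1 = INR n)%R by lra.
  by left; apply: ln_increasing => //; apply: exp_pos.
by right.
Qed.

Lemma up_log_le_ln n : 3 <= n -> (INR (up_log 2 n) <= 4 * ln (INR n))%R.
Proof.
move=> n3; have ln1 := one_le_ln n3.
have u_gt0 : 0 < up_log 2 n by rewrite up_log_gt0; lia.
have : expn 2 (up_log 2 n).-1 < n by apply: up_log_gtn; lia.
move/ltP/lt_INR; rewrite INR_expn2 -{2}(prednK u_gt0) S_INR.
move: (up_log 2 n).-1 => u h.
have : (ln (2 ^ u) < ln (INR n))%R by apply: ln_increasing => //; apply: pow_lt; lra.
rewrite ln_pow; last by lra.
have := ln_lt_2; have := pos_INR u; nra.
Qed.

(** Apply 1 + t <= exp t to the logarithm of the fourth root. This makes sqrt n exceed any multiple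
    of ln n beyond an explicit threshold. *)
Lemma ln_le_fourth_root (x : R) : (0 < x)%R -> (ln x <= 4 * sqrt (sqrt x))%R.
Proof.
move=> x_gt0; have s1 := sqrt_lt_R0 _ x_gt0; have s2 := sqrt_lt_R0 _ s1.
set y := sqrt (sqrt x).
have yy : (y * y = sqrt x)%R by apply: sqrt_sqrt; lra.
have xE : (x = (y * y) * (y * y))%R by rewrite yy sqrt_sqrt; lra.
have -> : (ln x = 4 * ln y)%R.
  by rewrite xE !ln_mult; try (by rewrite yy); rewrite -/y in s2; try lra.
have := exp_ineq1_le (ln y); rewrite exp_ln //; lra.
Qed.

(** The size of s makes the sites fit into n nodes. Here 3456 = 48 * 72: n <= 16 s^2 bounds the
    changes by 72 s^2, while s <= 24 (1 + 4B) (L - 1) gives s^3 <= 48 (1 + 4B) times the number of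
    inconsistent rounds. *)
Lemma hard_dyn_graph_params (n d B : nat) (s := Nat.sqrt n %/ 2)
    (A : DDS n) (c : R) :
  bandwidth A B -> lists_kcycles (6 + d) A -> amortized_le (6 + d) A c ->
  d.+2 <= s -> 16 * (1 + 4 * B) <= s ->
  (INR s <= 3456 * INR (1 + 4 * B) * c)%R /\ (0 < c)%R.
Proof.
move=> bw lists amort d_le B_le.
have [sqr_le lt_sqr] := Nat.sqrt_spec n (Nat.le_0_l n).
have s2 : 2 * s <= Nat.sqrt n by rewrite /s; lia.
have s2' : Nat.sqrt n <= 2 * s + 1 by rewrite /s; lia.
move: s (Nat.sqrt n) => {}s r in d_le B_le sqr_le lt_sqr s2 s2' *.
(* This L keeps 4 L (1 + 4B) at most s/2, within what the counting allows. *)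
pose L := s %/ (8 * (1 + 4 * B)).
have L2 : 2 <= L by rewrite leq_divRL; lia.
have L_le : L * (8 * (1 + 4 * B)) <= s by exact: leq_divM.
have L_gt : s < L.+1 * (8 * (1 + 4 * B)) by rewrite -ltn_divLR //; lia.
have site_le : 2 * s * (s + d.+2) <= n by nia.
have n_le : n <= 16 * (s * s) by nia.
have [|G [i [valid bad ch]]] := hard_dyn_graph (L := L) bw lists (ltnW L2) site_le.
  by lia.
have := amort G valid i; move: bad ch.
set Y := \sum_(_ <= _ < _) _; set X := \sum_(_ <= _ < _) _ => bad ch hc.
have s_gt0 : 0 < s by lia.
have hX : (INR X <= 72 * (INR s * INR s))%R.
  have /INR_leq : X <= 72 * (s * s) by lia.
  by rewrite !INR_muln [INR 72]INR_IZR_INZ.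
have hY : (INR s * (INR s * INR s) <= 48 * (INR (1 + 4 * B) * INR Y))%R.
  have /INR_leq : s * (s * s) <= 48 * ((1 + 4 * B) * Y).
    have sL : s <= 24 * (1 + 4 * B) * L.-1 by nia.
    apply: leq_trans (leq_mul sL (leqnn (s * s))) _.
    have := leq_mul (leqnn (24 * (1 + 4 * B))) bad; lia.
  by rewrite !INR_muln [INR 48]INR_IZR_INZ.
have s0 : (0 < INR s)%R by apply: lt_0_INR; lia.
have b0 : (0 < INR (1 + 4 * B))%R by apply: lt_0_INR; lia.
have X0 := pos_INR X; have Y0 := pos_INR Y.
move: (INR s) (INR (1 + 4 * B)) (INR X) (INR Y) => u b x y
  in hc hX hY s0 b0 X0 Y0 *.
have u2 : (0 < u * u)%R by nra.
have y0 : (0 < y)%R.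
  have u3 : (0 < u * (u * u))%R by apply: Rmult_lt_0_compat.
  by apply: Rnot_le_lt => y_le0; nra.
have c0 : (0 < c)%R by apply: Rnot_le_lt => c0; nra.
split => //; apply: (Rmult_le_reg_r (u * u)) => //.
have cx : (c * x <= c * (72 * (u * u)))%R by apply: Rmult_le_compat_l; lra.
have yx : (b * y <= b * (c * (72 * (u * u))))%R by apply: Rmult_le_compat_l; lra.
by lra.
Qed.

Theorem theorem5 :
  forall k : nat, 6 <= k ->
  forall Bw : nat,
  exists eps : R, Rlt 0 eps /\
  exists n0 : nat, forall n : nat, n0 <= n ->
  forall A : DDS n,
    bandwidth A (Bw * up_log 2 n) ->
    lists_kcycles k A ->
    forall c : R, amortized_le k A c ->
      Rle (Rdiv (Rmult eps (sqrt (INR n))) (ln (INR n))) c.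
Proof.
move=> k k6 Bw; set d := k - 6; have kE : k = 6 + d by rewrite /d; lia.
(* [K * ln n] will dominate 1 + 4B, since [up_log 2 n] is at most 4 ln n and 1 <= ln n. *)
pose K := INR (1 + 16 * Bw).
have K1 : (1 <= K)%R by have := INR_leq (isT : 1 <= 1 + 16 * Bw).
(* 13824 = 4 * 3456, the factor 4 coming from sqrt n <= 4 s. *)
exists (/ (13824 * K))%R; split; first by apply: Rinv_0_lt_compat; lra.
(* The fourth power yields sqrt n >= 64 K ln n through the fourth root, the square leaves room for
   the path of length d, and 3 ensures ln n >= 1. *)
exists (expn (256 * (1 + 16 * Bw)) 4 + expn (2 * d + 6) 2 + 3) => n n_ge A bw lists c amort.
rewrite kE in lists amort.
have n3 : 3 <= n by lia.
have ln1 := one_le_ln n3; have ulog := up_log_le_ln n3.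
have KE : K = (1 + 16 * INR Bw)%R.
  by rewrite /K -plusE plus_INR INR_muln [INR 16]INR_IZR_INZ.
have Bw0 := pos_INR Bw.
have B_le : (INR (1 + 4 * (Bw * up_log 2 n)) <= K * ln (INR n))%R.
  rewrite -plusE plus_INR !INR_muln [INR 4]INR_IZR_INZ KE /=.
  have := Rmult_le_compat_l _ _ _ Bw0 ulog; lra.
have sqrt_ge : (64 * K * ln (INR n) <= sqrt (INR n))%R.
  have n_gt0 : (0 < INR n)%R by apply: lt_0_INR; lia.
  have := ln_le_fourth_root n_gt0.
  set q := (256 * K)%R; have q0 : (0 <= q)%R by rewrite /q; lra.
  have root_ge : (q <= sqrt (sqrt (INR n)))%R.
    rewrite -(sqrt_square q) // -(sqrt_square (q * q)); last by nra.
    do 2 apply: sqrt_le_1_alt.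
    have /INR_leq : expn (256 * (1 + 16 * Bw)) 4 <= n by lia.
    by rewrite !expnS expn0 muln1 !INR_muln -/K [INR 256]INR_IZR_INZ /= -/q; lra.
  have := sqrt_sqrt _ (sqrt_pos (INR n)).
  by move: (sqrt (sqrt _)) root_ge => y; rewrite /q; nra.
have [sqr_le lt_sqr] := Nat.sqrt_spec n (Nat.le_0_l n).
have r_ge : 2 * d + 6 <= Nat.sqrt n.
  have : expn (2 * d + 6) 2 <= n by lia.
  by rewrite expnS expn1; nia.
have sqrt_le : (sqrt (INR n) <= 4 * INR (Nat.sqrt n %/ 2))%R.
  have s0 := pos_INR (Nat.sqrt n %/ 2).
  rewrite -[X in (_ <= X)%R]sqrt_square; last by lra.
  apply: sqrt_le_1_alt.
  have /INR_leq : n <= 16 * (Nat.sqrt n %/ 2 * (Nat.sqrt n %/ 2)).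
    have : Nat.sqrt n <= 2 * (Nat.sqrt n %/ 2) + 1 by lia.
    have : 3 <= Nat.sqrt n %/ 2 by lia.
    by move: (Nat.sqrt n) (_ %/ _) lt_sqr => r s; nia.
  by rewrite !INR_muln [INR 16]INR_IZR_INZ /=; lra.
have [||s_le c_gt0] := hard_dyn_graph_params bw lists amort.
- by lia.
- apply/leP/INR_le; rewrite INR_muln [INR 16]INR_IZR_INZ.
  by change (IZR (Z.of_nat 16)) with 16%R; lra.
apply: (Rmult_le_reg_r (ln (INR n))); first by lra.
rewrite /Rdiv Rmult_assoc Rinv_l ?Rmult_1_r; last by lra.
apply: (Rmult_le_reg_l (13824 * K)%R); first by lra.
rewrite -Rmult_assoc Rinv_r ?Rmult_1_l; last by lra.
by have := Rmult_le_compat_r _ _ _ (Rlt_le _ _ c_gt0) B_le; lra.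
Qed.
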